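(* Let $n\ge 2$, let $k=k(t,n)$ be any of the digital adjacencies of $\mathbb{Z}^n$, let $l$ be a prime number with $l\notin\{2,3\}$, and let $SC_k^{n,l}=(x_i)_{i\in\{0,\dots,l-1\}}$ be a simple closed $k$-curve with $l$ elements in $\mathbb{Z}^n$, equipped with the operations $x_i\ast_1 x_j=x_{i+j\,(\mathrm{mod}\,l)}$ and $x_i\star x_j=x_{i\cdot j\,(\mathrm{mod}\,l)}$. Then $(SC_k^{n,l},\ast_1,\star)$ (with the $k$-adjacency) is not a $DT$-$k$-field.
   Context: For $1\le t\le n$, two distinct points of $\mathbb{Z}^n$ are $k(t,n)$-adjacent if at most $t$ of their coordinates differ by $\pm1$ and all the other coordinates coincide; the adjacency is named by the number $k=k(t,n)=\sum_{i=1}^{t}2^i\binom{n}{i}$. A digital image $(X,k)$ is a set $X\subset\mathbb{Z}^n$ with such an adjacency; for $x\in X$, $N_k(x,1)=\{y\in X: y \text{ is } k\text{-adjacent to } x\}\cup\{x\}$. A map $f:(X,k)\to(X,k)$ is $k$-continuous if $f(N_k(x,1))\subset N_{k}(f(x),1)$ for all $x\in X$. For $(X,k)$ with $k=k(t,n)$, put $k^\ast:=k(t,2n)$ (only a label). Distinct points $p=(x_1,x_2)$, $q$ of $X^2=X\times X$ are $G_{k^\ast}$-adjacent if $q\in (N_k(x_1,1)\times\{x_2\})\cup(\{x_1\}\times N_k(x_2,1))$; $N_{G_{k^\ast}}(p,1)$ is the set of points $G_{k^\ast}$-adjacent to $p$, together with $p$. A map $f:(X^2,G_{k^\ast})\to(X,k)$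 is $(G_{k^\ast},k)$-continuous if $f(N_{G_{k^\ast}}(p,1))\subset N_k(f(p),1)$ for all $p\in X^2$. A $DT$-$k$-group $(X,k,\ast_1)$ is a digital image $(X,k)$ with a group structure $(X,\ast_1)$ such that $(x,y)\mapsto x\ast_1 y$ is $(G_{k^\ast},k)$-continuous and the inverse map $x\mapsto x^{-1}$ of $\ast_1$ is $k$-continuous; it is abelian if $(X,\ast_1)$ is. A $DT$-$k$-ring $(X,k,\ast_1,\star)$ is an abelian $DT$-$k$-group $(X,k,\ast_1)$ together with a ring structure $(X,\ast_1,\star)$ such that $(x,y)\mapsto x\star y$ is also $(G_{k^\ast},k)$-continuous; it is commutative if the ring is. A $DT$-$k$-field is a commutative $DT$-$k$-ring $(X,k,\ast_1,\star)$ such that $(X,\ast_1,\star)$ is a field and, with $x_0$ the identity of $\ast_1$ and $X'=X\setminus\{x_0\}$, the map $X'\to X'$ sending $x$ to its $\star$-inverse is $k$-continuous on $(X',k)$. A simple closed $k$-curve with $l$ elements in $\mathbb{Z}^n$ ($l\ge 4$, $n\ge 2$), denoted $SC_k^{n,l}$, is a sequence $(x_i)_{i\in\{0,\dots,l-1\}}$ of $l$ distinct points of $\mathbb{Z}^n$ such that $x_i$ and $x_j$ are $k$-adjacent if and only if $i-j\equiv\pm1\pmod l$. Indices mod $l$ are reduced to $\{0,\dots,l-1\}$. *)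

(* Defs.v *)
From HB Require Import structures.
From mathcomp Require Import all_boot all_order all_algebra.
Set Implicit Arguments.
Unset Strict Implicit.
Unset Printing Implicit Defensive.
Import Order.TTheory GRing.Theory Num.Theory.

(* Points of Z^n are row vectors.  The k(t,n)-adjacency is indexed by t: the
   number k(t,n) = \sum_(1 <= i < t.+1) 2 ^ i * 'C(n, i) is only its name
   (and is strictly increasing in t for t <= n). *)
Definition kadj (n t : nat) (p q : 'rV[int]_n) : bool :=
  [&& p != q,
      [forall i, (p 0%R i == q 0%R i) || (`|p 0 i - q 0 i| == 1)%R] &
      #|[set i | (`|p 0 i - q 0 i| == 1)%R]| <= t].

(* A digital image is a subset X of Z^n; maps and operations on it live on the
   subtype of its points. *)
Definition points (n : nat) (X : {pred 'rV[int]_n}) := {p : 'rV[int]_n | p \in X}.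

Definition kneighborhood (n t : nat) (X : {pred 'rV[int]_n}) (x : points X) :
    {pred points X} :=
  [pred y : points X | kadj t (val y) (val x) || (y == x)].

Definition kcontinuous (n t : nat) (X : {pred 'rV[int]_n})
    (f : points X -> points X) : Prop :=
  forall x y, y \in kneighborhood t x -> f y \in kneighborhood t (f x).

Definition Gadj (n t : nat) (X : {pred 'rV[int]_n})
    (p q : points X * points X) : bool :=
  (p != q) && ((q.1 \in kneighborhood t p.1) && (q.2 == p.2)
               || (q.1 == p.1) && (q.2 \in kneighborhood t p.2)).

Definition Gneighborhood (n t : nat) (X : {pred 'rV[int]_n})
    (p : points X * points X) : {pred points X * points X} :=
  [pred q : points X * points X | Gadj t p q || (q == p)].

(* Continuity of a binary operation as a map from X * X to X. *)
Definition Gcontinuous (n t : nat) (X : {pred 'rV[int]_n})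
    (op : points X -> points X -> points X) : Prop :=
  forall p q, q \in Gneighborhood t p ->
    op q.1 q.2 \in kneighborhood t (op p.1 p.2).

Definition is_identity (T : Type) (op : T -> T -> T) (e : T) : Prop :=
  left_id e op /\ right_id e op.

Definition is_group (T : Type) (op : T -> T -> T) (e : T) (inv : T -> T) : Prop :=
  [/\ associative op, is_identity op e,
      left_inverse e inv op & right_inverse e inv op].

Definition is_ring (T : Type) (add mul : T -> T -> T) : Prop :=
  [/\ (exists zero opp, is_group add zero opp) /\ commutative add,
      associative mul,
      (exists one, is_identity mul one),
      left_distributive mul add &
      right_distributive mul add].

Definition is_field (T : Type) (add mul : T -> T -> T) : Prop :=
  [/\ is_ring add mul, commutative mul &
      exists zero one, [/\ is_identity add zero, is_identity mul one,
        one <> zero &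
        forall x, x <> zero -> exists y, mul x y = one /\ mul y x = one]].

Definition DT_group (n t : nat) (X : {pred 'rV[int]_n})
    (op : points X -> points X -> points X) : Prop :=
  exists e inv, [/\ is_group op e inv, Gcontinuous t op & kcontinuous t inv].

Definition DT_ring (n t : nat) (X : {pred 'rV[int]_n})
    (add mul : points X -> points X -> points X) : Prop :=
  [/\ DT_group t add, commutative add, is_ring add mul & Gcontinuous t mul].

Definition puncture (n : nat) (X : {pred 'rV[int]_n}) (x0 : points X) :
    {pred 'rV[int]_n} :=
  [pred p | (p != val x0) && (p \in X)].

Lemma puncture_sub (n : nat) (X : {pred 'rV[int]_n}) (x0 : points X)
    (u : points (puncture x0)) : val u \in X.
Proof. by case/andP: (valP u). Qed.

Definition puncture_incl (n : nat) (X : {pred 'rV[int]_n}) (x0 : points X)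
    (u : points (puncture x0)) : points X :=
  exist _ (val u) (puncture_sub u).

(* The last clause is about the digital image X' = X minus the zero: [inv] is
   the map from X' to X' taking multiplicative inverses. *)
Definition DT_field (n t : nat) (X : {pred 'rV[int]_n})
    (add mul : points X -> points X -> points X) : Prop :=
  [/\ DT_ring t add mul, commutative mul, is_field add mul &
      exists zero one (inv : points (puncture zero) -> points (puncture zero)),
        [/\ is_identity add zero, is_identity mul one,
            forall u, mul (puncture_incl u) (puncture_incl (inv u)) = one &
            kcontinuous t inv]].

Definition simple_closed_curve (n t l : nat) (x : 'I_l -> 'rV[int]_n) : Prop :=
  [/\ 2 <= n, 4 <= l, injective x &
      forall i j : 'I_l,
        kadj t (x i) (x j) <-> (i = j.+1 %[mod l] \/ j = i.+1 %[mod l])].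

Definition curve_image (n l : nat) (x : 'I_l -> 'rV[int]_n) :
    {pred 'rV[int]_n} := [pred p | p \in codom x].

Definition curve_point (n l : nat) (x : 'I_l -> 'rV[int]_n) (i : 'I_l) :
    points (curve_image x) :=
  exist _ (x i) (codom_f x i).

(* Main.v *)
(** Already the multiplication fails to be continuous: [x_1] and [x_2] are
    adjacent, but multiplying them by [x_2] gives [x_2] and [x_4], which are
    neither equal nor adjacent on a closed curve with [l >= 5] elements. *)
Require Import Defs.
From HB Require Import structures.
From mathcomp Require Import all_boot all_order all_algebra.
Set Implicit Arguments.
Unset Strict Implicit.
Unset Printing Implicit Defensive.
Import Order.TTheory GRing.Theory Num.Theory.

Lemma Gcontinuousr (n t : nat) (X : {pred 'rV[int]_n})
    (op : points X -> points X -> points X) (a b c : points X) :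
  Gcontinuous t op -> c \in kneighborhood t b ->
  op a c \in kneighborhood t (op a b).
Proof.
move=> cont bc; apply: (cont (a, b) (a, c)).
(* If [c = b] the two pairs coincide and [Gadj] fails, but then the clause [q == p] of
   [Gneighborhood] holds; [orNb] merges the two cases. *)
by rewrite inE /Gadj /= eqxx bc orbT andbT eq_sym orNb.
Qed.

(** Turns the geometry into congruences between indices; injectivity of [x] is what makes the centre
    of the neighborhood yield [i = j]. *)
Lemma curve_neighborhoodE (n t l : nat) (x : 'I_l -> 'rV[int]_n) (i j : 'I_l) :
  simple_closed_curve t x ->
  curve_point x i \in kneighborhood t (curve_point x j) <->
  [\/ i = j, i = j.+1 %[mod l] | j = i.+1 %[mod l]].
Proof.
case=> _ _ x_inj adj; rewrite inE /=; split.
  case/orP=> [/adj[] ?|/eqP/(congr1 val)/x_inj ?];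
    by [constructor 2 | constructor 3 | constructor 1].
case=> [->|ij|ij]; first by rewrite eqxx orbT.
  by apply/orP; left; apply/adj; left.
by apply/orP; left; apply/adj; right.
Qed.

Theorem mainTheorem5 (n t l : nat) (hn : 2 <= n) (ht : 1 <= t <= n)
    (hl : prime l) (hl23 : l \notin [:: 2; 3])
    (x : 'I_l -> 'rV[int]_n) (hx : simple_closed_curve t x)
    (add mul : points (curve_image x) -> points (curve_image x) ->
               points (curve_image x))
    (hadd : forall i j m : 'I_l, m = (i + j) %% l :> nat ->
      add (curve_point x i) (curve_point x j) = curve_point x m)
    (hmul : forall i j m : 'I_l, m = (i * j) %% l :> nat ->
      mul (curve_point x i) (curve_point x j) = curve_point x m) :
  ~ DT_field t add mul.
Proof.
case=> -[_ _ _ cont_mul] _ _ _.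
(* Primality excludes 0, 1 and 4, and [hl23] excludes 2 and 3; hence 4 is a valid index. *)
have l_gt4 : 4 < l by case: l hl hl23 {x hx add mul hadd hmul cont_mul} => [|[|[|[|[|]]]]].
pose i1 : 'I_l := Ordinal (ltn_trans (isT : 1 < 4) l_gt4).
pose i2 : 'I_l := Ordinal (ltn_trans (isT : 2 < 4) l_gt4).
pose i4 : 'I_l := Ordinal l_gt4.
have adj12 : curve_point x i2 \in kneighborhood t (curve_point x i1).
  by apply/curve_neighborhoodE => //; constructor 2.
have := Gcontinuousr (curve_point x i2) cont_mul adj12.
rewrite (hmul i2 i2 i4) ?(hmul i2 i1 i2) /= ?modn_small //; last first.
  by rewrite (ltn_trans _ l_gt4).
(* The cases are 4 = 2, then 4 = 3 and 2 = 5 modulo [l]. Cancelling 3 turns the second into 1 = 0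
   modulo [l]. *)
case/(curve_neighborhoodE _ _ hx) => [/(congr1 val) //||] /eqP.
  by rewrite /= -[4]/(1 + 3) -{2}[3]/(0 + 3) eqn_modDr !modn_small ?(ltn_trans _ l_gt4).
(* Since [l] may be 5, the residue of 5 need not be 5; cancelling 2 first leaves 0 = 3 modulo [l],
   where both sides are below [l]. *)
rewrite /= -{1}[2]/(0 + 2) -[5]/(3 + 2) eqn_modDr.
by rewrite !modn_small ?(ltn_trans _ l_gt4).
Qed.
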